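(* Let $A\in\mathbb{S}\subset\mathbb{K}^{n\times n}$, let $\mathcal{X}_a$ be a subspace of $\mathbb{K}^n$ of dimension $p$, and let $X_a\in\mathbb{K}^{n\times p}$ be a full column rank matrix with $\mathfrak{R}(X_a)=\mathcal{X}_a$. Then $\mathcal{X}_a$ is an invariant subspace of $A+\Delta A$ for some $\Delta A\in\mathbb{S}$ if and only if there exists $\Lambda_a\in\mathbb{K}^{p\times p}$ such that $$X_a^\star HX_a\Lambda_a=\epsilon_2\Lambda_a^\star X_a^\star HX_a.$$ If such a matrix $\Lambda_a$ exists, then the matrices $\Delta A\in\mathbb{S}$ such that $(A+\Delta A)X_a=X_a\Lambda_a$ are exactly those of the form $$\Delta A=(X_a\Lambda_a-AX_a)X_a^{\dagger}+\epsilon_1\epsilon_2H^{-1}\left[\left(H(X_a\Lambda_a-AX_a)X_a^{\dagger}\right)^\star-(X_a^{\dagger})^\star\left(X_a^\star HX_a\Lambda_a-X_a^\star HAX_a\right)^\star X_a^{\dagger}\right]+H^{-1}(I-X_aX_a^{\dagger})^\star Z(I-X_aX_a^{\dagger}),$$ where $Z\in\mathbb{K}^{n\times n}$ satisfies $Z^\star=\epsilon_1\epsilon_2Z$. In particular, the matrix $\Delta A=\Delta A_o$ obtained by setting $Z=0$ is the minimal perturbation, i.e. it has the smallest Frobenius norm among all $\Delta A\in\mathbb{S}$ with $(A+\Delta A)X_a=X_a\Lambda_a$.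
   Context: $\mathbb{K}\in\{\mathbb{R},\mathbb{C}\}$ and $\star\in\{T,*\}$ (transpose or conjugate transpose). $H\in\mathbb{K}^{n\times n}$ is a fixed unitary matrix with $H^\star=\epsilon_1H$, $\epsilon_1\in\{1,-1\}$. For $A\in\mathbb{K}^{n\times n}$ put $A^{[\star]}=H^{-1}A^\star H$ (the adjoint with respect to $\langle x,y\rangle_H=y^\star Hx$). Let $\mathbb{L}=\{A\in\mathbb{K}^{n\times n}:A^{[\star]}=-A\}$ (Lie algebra) and $\mathbb{J}=\{A\in\mathbb{K}^{n\times n}:A^{[\star]}=A\}$ (Jordan algebra). $\mathbb{S}\in\{\mathbb{L},\mathbb{J}\}$, with $\epsilon_2=1$ if $\mathbb{S}=\mathbb{J}$ and $\epsilon_2=-1$ if $\mathbb{S}=\mathbb{L}$, so $A\in\mathbb{S}$ iff $A^{[\star]}=\epsilon_2A$. $X^\dagger$ is the Moore-Penrose pseudoinverse, $\mathfrak{R}(X)$ is the column space of $X$, and $I$ is the identity of order $n$. *)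

(* Defs.v *)
From HB Require Import structures.
From mathcomp Require Import all_boot all_order all_algebra.
From mathcomp Require Import boolp classical_sets reals.
From mathcomp Require Import complex.

Set Implicit Arguments.
Unset Strict Implicit.
Unset Printing Implicit Defensive.

Import Order.TTheory GRing.Theory Num.Theory.

Local Open Scope ring_scope.

Variant scalar_kind := RealScalars | ComplexScalars.

Definition scalars (R : realType) (k : scalar_kind) : numFieldType :=
  match k with RealScalars => R | ComplexScalars => R[i] end.

Definition cj (R : realType) (k : scalar_kind) :
    {rmorphism scalars R k -> scalars R k} :=
  match k return {rmorphism scalars R k -> scalars R k} with
  | RealScalars => idfun
  | ComplexScalars => @conjc R
  end.

(* The modulus, as an element of R: the library norm of R[i] has values in R[i]. *)
Definition modulus (R : realType) (k : scalar_kind) : scalars R k -> R :=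
  match k return scalars R k -> R with
  | RealScalars => fun x => `|x|
  | ComplexScalars => @Normc.normc R
  end.

Definition frobenius (R : realType) (k : scalar_kind) (m n : nat)
    (M : 'M[scalars R k]_(m, n)) : R :=
  Num.sqrt (\sum_i \sum_j modulus (M i j) ^+ 2).

Definition ctrmx (R : realType) (k : scalar_kind) (m n : nat)
    (M : 'M[scalars R k]_(m, n)) : 'M[scalars R k]_(n, m) :=
  map_mx (cj R k) M^T.

Variant star_kind := Transpose | ConjTranspose.

Definition starmx (R : realType) (k : scalar_kind) (s : star_kind) (m n : nat)
    (M : 'M[scalars R k]_(m, n)) : 'M[scalars R k]_(n, m) :=
  match s with Transpose => M^T | ConjTranspose => ctrmx M end.

(* "Unitary" and the pseudoinverse refer to the conjugate transpose, whichever
   of the two operations starmx denotes. *)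
Definition unitary (R : realType) (k : scalar_kind) (n : nat)
    (H : 'M[scalars R k]_n) : Prop :=
  ctrmx H *m H = 1%:M.

Definition penrose (R : realType) (k : scalar_kind) (m n : nat)
    (X : 'M[scalars R k]_(m, n)) (Y : 'M[scalars R k]_(n, m)) : Prop :=
  [/\ X *m Y *m X = X, Y *m X *m Y = Y,
      ctrmx (X *m Y) = X *m Y & ctrmx (Y *m X) = Y *m X].

(* The default value 0 is never used: see pseudoinverseP. *)
Definition pseudoinverse (R : realType) (k : scalar_kind) (m n : nat)
    (X : 'M[scalars R k]_(m, n)) : 'M[scalars R k]_(n, m) :=
  xget 0 (penrose X).

Definition adjoint (R : realType) (k : scalar_kind) (s : star_kind) (n : nat)
    (H A : 'M[scalars R k]_n) : 'M[scalars R k]_n :=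
  invmx H *m starmx s A *m H.

Variant algebra_kind := Lie | Jordan.

Definition structured (R : realType) (k : scalar_kind) (s : star_kind)
    (S : algebra_kind) (n : nat) (H A : 'M[scalars R k]_n) : Prop :=
  match S with
  | Lie => adjoint s H A = - A
  | Jordan => adjoint s H A = A
  end.

Definition eps2 (R : realType) (k : scalar_kind) (S : algebra_kind) :
    scalars R k :=
  match S with Lie => -1 | Jordan => 1 end.

Lemma structuredE (R : realType) (k : scalar_kind) (s : star_kind)
    (S : algebra_kind) (n : nat) (H A : 'M[scalars R k]_n) :
  structured s S H A <-> adjoint s H A = eps2 R k S *: A.
Proof. by case: S; rewrite /= ?scaleN1r ?scale1r. Qed.

Definition colspace (R : realType) (k : scalar_kind) (m n : nat)
    (X : 'M[scalars R k]_(m, n)) : {vspace 'cV[scalars R k]_m} :=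
  <<[seq col j X | j <- enum 'I_n]>>%VS.

Definition invariant_subspace (R : realType) (k : scalar_kind) (n : nat)
    (M : 'M[scalars R k]_n) (U : {vspace 'cV[scalars R k]_n}) : Prop :=
  forall v, v \in U -> M *m v \in U.

Definition perturbation (R : realType) (k : scalar_kind) (s : star_kind)
    (S : algebra_kind) (n p : nat) (eps1 : scalars R k)
    (H A : 'M[scalars R k]_n) (X : 'M[scalars R k]_(n, p))
    (L : 'M[scalars R k]_p) (Z : 'M[scalars R k]_n) : 'M[scalars R k]_n :=
  let Xd := pseudoinverse X in
  let P := 1%:M - X *m Xd in
  (X *m L - A *m X) *m Xd
  + (eps1 * eps2 R k S) *:
      (invmx H *m
        (starmx s (H *m (X *m L - A *m X) *m Xd)
         - starmx s Xd
           *m starmx s (starmx s X *m H *m X *m L - starmx s X *m H *m A *m X)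
           *m Xd))
  + invmx H *m starmx s P *m Z *m P.

Section Pseudoinverse.

Variables (R : realType) (k : scalar_kind).
Local Notation K := (scalars R k).

Lemma cjK : involutive (cj R k).
Proof. by case: k => //= x; exact: conjcK. Qed.

Lemma mul_cj (x : K) : x * cj R k x = `|x| ^+ 2.
Proof.
case: k x => /= x; first by rewrite real_normK ?num_real // expr2.
by rewrite sqr_normc.
Qed.

Lemma ctrmxK m n (M : 'M[K]_(m, n)) : ctrmx (ctrmx M) = M.
Proof. by apply/matrixP=> i j; rewrite !mxE cjK. Qed.

Lemma ctrmxM m n q (M : 'M[K]_(m, n)) (N : 'M[K]_(n, q)) :
  ctrmx (M *m N) = ctrmx N *m ctrmx M.
Proof. by rewrite /ctrmx trmx_mul map_mxM. Qed.

Lemma mul_ctrmx_eq0 m n (M : 'M[K]_(m, n)) : M *m ctrmx M = 0 -> M = 0.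
Proof.
move=> M0; apply/matrixP=> i j; rewrite mxE.
have /eqP := congr1 (fun N : 'M_m => N i i) M0.
rewrite !mxE psumr_eq0 => [/allP/(_ j)|l _]; last first.
  by rewrite !mxE mul_cj exprn_ge0.
by rewrite mem_index_enum !mxE mul_cj expf_eq0 normr_eq0 => /(_ isT)/eqP.
Qed.

Lemma unitmx_mul_ctrmx m n (G : 'M[K]_(m, n)) :
  row_free G -> G *m ctrmx G \in unitmx.
Proof.
move=> Gfree; rewrite -row_free_unit -kermx_eq0; apply/eqP.
set N := kermx _; have NG : N *m (G *m ctrmx G) = 0 by exact: mulmx_ker.
have/mul_ctrmx_eq0 : (N *m G) *m ctrmx (N *m G) = 0.
  by rewrite ctrmxM mulmxA -(mulmxA N) NG mul0mx.
by rewrite -[RHS](mul0mx _ G) => /(row_free_inj Gfree).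
Qed.

Lemma unitmx_ctrmx_mul m n (F : 'M[K]_(m, n)) :
  row_full F -> ctrmx F *m F \in unitmx.
Proof.
move=> Ffull; rewrite -{2}[F]ctrmxK; apply: unitmx_mul_ctrmx.
by rewrite /row_free /ctrmx mxrank_map mxrank_tr.
Qed.

Lemma ctrmx_inv n (M : 'M[K]_n) : ctrmx (invmx M) = invmx (ctrmx M).
Proof. by rewrite /ctrmx trmx_inv map_invmx. Qed.

Lemma penrose_full_rank_factorization m r n (F : 'M[K]_(m, r))
    (G : 'M[K]_(r, n)) :
  row_full F -> row_free G ->
  penrose (F *m G) (ctrmx G *m invmx (G *m ctrmx G)
                    *m (invmx (ctrmx F *m F) *m ctrmx F)).
Proof.
move=> /unitmx_ctrmx_mul uF /unitmx_mul_ctrmx uG.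
set Y := _ *m (_ *m _).
have XY : (F *m G) *m Y = F *m invmx (ctrmx F *m F) *m ctrmx F.
  rewrite /Y !mulmxA -(mulmxA F G) -(mulmxA F (G *m _)) mulmxV //.
  by rewrite mulmx1.
have YX : Y *m (F *m G) = ctrmx G *m invmx (G *m ctrmx G) *m G.
  rewrite /Y !mulmxA -(mulmxA _ (ctrmx F)) -(mulmxA _ (invmx (ctrmx F *m F))).
  by rewrite mulVmx // mulmx1.
split.
- rewrite XY !mulmxA -(mulmxA _ (ctrmx F)) -(mulmxA F) mulVmx //.
  by rewrite mulmx1.
- rewrite YX /Y !mulmxA -(mulmxA _ G) -(mulmxA _ (G *m _) (invmx _)).
  by rewrite mulmxV // mulmx1.
- by rewrite XY !ctrmxM ctrmx_inv ctrmxM ctrmxK mulmxA.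
- by rewrite YX !ctrmxM ctrmx_inv ctrmxM ctrmxK mulmxA.
Qed.

Lemma penrose_exists m n (X : 'M[K]_(m, n)) : exists Y, penrose X Y.
Proof.
have := penrose_full_rank_factorization (col_base_full X) (row_base_free X).
by rewrite mulmx_base => XY; exists (ctrmx (row_base X) *m
  invmx (row_base X *m ctrmx (row_base X)) *m
  (invmx (ctrmx (col_base X) *m col_base X) *m ctrmx (col_base X))).
Qed.

Lemma penrose_unique m n (X : 'M[K]_(m, n)) Y1 Y2 :
  penrose X Y1 -> penrose X Y2 -> Y1 = Y2.
Proof.
case=> a1 b1 c1 d1 [a2 b2 c2 d2].
have e1 : Y1 = Y1 *m X *m Y2.
  rewrite -{1}b1 -[LHS]mulmxA -c1 -{1}a2 -mulmxA ctrmxM c1 c2.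
  by rewrite !mulmxA b1.
have e2 : Y2 = Y1 *m X *m Y2.
  by rewrite -{1}b2 -d2 -{1}a1 -mulmxA mulmxA ctrmxM d2 d1 -!mulmxA (mulmxA Y2) b2.
by rewrite e1 -e2.
Qed.

Lemma pseudoinverseP m n (X : 'M[K]_(m, n)) : penrose X (pseudoinverse X).
Proof. by case: (penrose_exists X) => Y XY; apply: (xgetI 0 XY). Qed.

End Pseudoinverse.

(* Main.v *)
(* With W = H *m dA, structure of dA amounts to W^star = d W, d = eps1 eps2, and
   (A + dA) X = X L to W X = H B, where B = X L - A X.  Multiplying by X^star on
   the left, (X^star H B)^star = d X^star H B is necessary; as H *m A is itself
   d-symmetric, this is the condition on L.  Conversely, since X^dagger X = I,
     W0 = H B X^dagger + d (X^dagger)^star (H B)^star P,  P = I - X X^dagger,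
   is then a solution, and two solutions differ by some D with D^star = d D and
   D X = 0, that is, D = P^star D P.  As X^dagger P = 0 and P is an orthogonal
   projector, P^star D P is Frobenius-orthogonal to W0; H being unitary,
   Pythagoras gives minimality. *)
Require Import Defs.
From mathcomp Require Import all_boot all_order all_algebra.
From mathcomp Require Import reals complex.

Import Order.TTheory GRing.Theory Num.Theory.
Local Open Scope ring_scope.

(** * Algebra of the operations [starmx] and [ctrmx] *)

Section Star.

Context {R : realType} {k : scalar_kind} (s : star_kind).
Local Notation K := (scalars R k).

Lemma ctrmxD m n (M N : 'M[K]_(m, n)) : ctrmx (M + N) = ctrmx M + ctrmx N.
Proof. by rewrite /ctrmx linearD map_mxD. Qed.

Lemma ctrmxZ m n (a : K) (M : 'M[K]_(m, n)) :
  ctrmx (a *: M) = cj R k a *: ctrmx M.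
Proof. by rewrite /ctrmx linearZ map_mxZ. Qed.

Lemma starmxK m n (M : 'M[K]_(m, n)) : starmx s (starmx s M) = M.
Proof. by case: s; rewrite /= ?trmxK ?ctrmxK. Qed.

Lemma starmxM {m n q} (M : 'M[K]_(m, n)) (N : 'M[K]_(n, q)) :
  starmx s (M *m N) = starmx s N *m starmx s M.
Proof. by case: s; rewrite /= ?trmx_mul ?ctrmxM. Qed.

Lemma starmxD m n (M N : 'M[K]_(m, n)) :
  starmx s (M + N) = starmx s M + starmx s N.
Proof. by case: s; rewrite /= ?ctrmxD ?linearD. Qed.

Lemma starmxZ m n (a : K) (M : 'M[K]_(m, n)) :
  cj R k a = a -> starmx s (a *: M) = a *: starmx s M.
Proof. by move=> aR; case: s; rewrite /= ?ctrmxZ ?aR ?linearZ. Qed.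

Lemma starmxN m n (M : 'M[K]_(m, n)) : starmx s (- M) = - starmx s M.
Proof. by rewrite -!scaleN1r starmxZ // rmorphN1. Qed.

Lemma starmxB m n (M N : 'M[K]_(m, n)) :
  starmx s (M - N) = starmx s M - starmx s N.
Proof. by rewrite starmxD starmxN. Qed.

Lemma starmx1 n : starmx s (1%:M : 'M[K]_n) = 1%:M.
Proof. by case: s; rewrite /= /ctrmx trmx1 ?map_mx1. Qed.

Lemma starmx0 m n : starmx s (0 : 'M[K]_(m, n)) = 0.
Proof. by rewrite -[0](subrr 0) starmxB subrr. Qed.

(** Frobenius orthogonality is expressed with [ctrmx] for either choice of [s], so both operations
    meet in one formula. *)
Lemma ctrmx_starmx m n (M : 'M[K]_(m, n)) :
  ctrmx (starmx s M) = starmx s (ctrmx M).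
Proof. by case: s; rewrite //= /ctrmx map_trmx. Qed.

End Star.

(** * Frobenius norm and orthogonality *)

Lemma frobenius_le {R : realType} {k : scalar_kind} m n
    (M N : 'M[scalars R k]_(m, n)) :
  \tr (ctrmx M *m M) <= \tr (ctrmx N *m N) -> frobenius M <= frobenius N.
Proof.
have trE (E : 'M[scalars R k]_(m, n)) :
    \tr (ctrmx E *m E) = \sum_i \sum_j `|E i j| ^+ 2.
  rewrite exchange_big; apply: eq_bigr => j _; rewrite mxE.
  by apply: eq_bigr => i _; rewrite !mxE mulrC mul_cj.
rewrite !trE /frobenius => le_MN; apply: ler_wsqrtr.
case: k M N {trE} le_MN => M N /=; first exact.
(* Over [R[i]] both traces are embedded real sums of squares, so comparing them there amounts to
   comparing those sums in [R]. *)
have normE (E : 'M[R[i]]_(m, n)) : \sum_i \sum_j `|E i j| ^+ 2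
    = (\sum_i \sum_j Normc.normc (E i j) ^+ 2)%:C%C.
  rewrite rmorph_sum; apply: eq_bigr => i _.
  by rewrite rmorph_sum; apply: eq_bigr => j _; rewrite rmorphXn.
by rewrite !normE lecR.
Qed.

(** Pythagoras: the two cross traces are conjugate, so both vanish, and the trace of [ctrmx N *m N]
    is nonnegative. *)
Lemma frobenius_le_add_orthogonal {R : realType} {k : scalar_kind} m n
    (M N : 'M[scalars R k]_(m, n)) :
  \tr (ctrmx N *m M) = 0 -> frobenius M <= frobenius (M + N).
Proof.
move=> NM0; apply: frobenius_le.
have MN0 : \tr (ctrmx M *m N) = 0.
  rewrite -[N]ctrmxK -ctrmxM /ctrmx -map_trmx mxtrace_tr.
  by rewrite -/(ctrmx N) trace_map_mx NM0 rmorph0.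
rewrite ctrmxD mulmxDl !mulmxDr !linearD /= NM0 MN0 addr0 add0r lerDl.
apply: sumr_ge0 => j _; rewrite mxE; apply: sumr_ge0 => i _.
by rewrite !mxE mulrC mul_cj exprn_ge0.
Qed.

(** * Column spaces, invariance and full column rank *)

Lemma colspaceP {R : realType} {k : scalar_kind} {m n : nat}
    {X : 'M[scalars R k]_(m, n)} {v : 'cV[scalars R k]_m} :
  reflect (exists w, v = X *m w) (v \in colspace X).
Proof.
apply: (iffP idP) => [|[w ->]].
  move=> /(coord_span (X := in_tuple _)) ->.
  apply: (big_ind (fun u => exists w, u = X *m w)).
  - by exists 0; rewrite mulmx0.
  - by move=> _ _ [u ->] [w ->]; exists (u + w); rewrite mulmxDr.
  - move=> i _; have /mapP[j _ ->] :=
      mem_nth 0 (ltn_ord i : (i < size [seq col j X | j <- enum 'I_n])%N).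
    by exists (coord (in_tuple _) i v *: delta_mx j 0); rewrite -scalemxAr -colE.
have -> : X *m w = \sum_j w j 0 *: col j X.
  apply/colP=> i; rewrite mxE summxE; apply: eq_bigr => j _.
  by rewrite !mxE mulrC.
apply: rpred_sum => j _; apply: rpredZ; apply: memv_span.
by apply: map_f; rewrite mem_enum.
Qed.

Lemma invariant_colspaceP {R : realType} {k : scalar_kind} {n p : nat}
    (M : 'M[scalars R k]_n) (X : 'M[scalars R k]_(n, p)) :
  invariant_subspace M (colspace X) <-> exists L, M *m X = X *m L.
Proof.
split=> [invX | [L MX] v /colspaceP[w ->]]; last first.
  by apply/colspaceP; exists (L *m w); rewrite !mulmxA MX.
(* Column [j] of [L] will hold coefficients of [M *m col j X] in the columns of [X]. *)
have /fin_all_exists[w wP] j : exists w, M *m col j X = X *m w.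
  by apply/colspaceP/invX/colspaceP; exists (delta_mx j 0); rewrite -colE.
exists (\matrix_(i, j) w j i 0); apply/matrixP=> i j.
have /matrixP/(_ i 0) := wP j; rewrite !mxE => eq_ij.
transitivity (\sum_l M i l * col j X l 0).
  by apply: eq_bigr => l _; rewrite mxE.
by rewrite eq_ij; apply: eq_bigr => l _; rewrite mxE.
Qed.

(** Full column rank allows cancelling [X] on the left in X Y X = X; transposed, this is
    cancellation of a row-free right factor. *)
Lemma mulmx_pseudoinversel {R : realType} {k : scalar_kind} {n p : nat}
    {X : 'M[scalars R k]_(n, p)} :
  \rank X = p -> pseudoinverse X *m X = 1%:M.
Proof.
move=> rX; have [XYX _ _ _] := pseudoinverseP X.
have freeX : row_free X^T by rewrite /row_free mxrank_tr rX.
apply: trmx_inj; apply: (row_free_inj freeX).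
by rewrite -!trmx_mul mulmx1 mulmxA XYX.
Qed.

(** * Solutions of W X = C with W^star = d W *)

Section SymmetricSolutions.

Context {R : realType} {k : scalar_kind} (s : star_kind) {n p : nat}.
Local Notation K := (scalars R k).
Context {d : K} {X C : 'M[K]_(n, p)}.
Local Notation Y := (pseudoinverse X).
Local Notation P := (1%:M - X *m Y).

(** The first term alone solves W X = C; the second vanishes on [X] and repairs the symmetry. *)
Definition symmetric_solution : 'M[K]_n :=
  C *m Y + d *: (starmx s Y *m starmx s C *m P).

Hypotheses (dR : cj R k d = d) (dd : d * d = 1) (rX : \rank X = p).
Hypothesis XC : starmx s (starmx s X *m C) = d *: (starmx s X *m C).

Let YX : Y *m X = 1%:M := mulmx_pseudoinversel rX.

Lemma projX : P *m X = 0.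
Proof. by rewrite mulmxBl mul1mx -mulmxA YX mulmx1 subrr. Qed.

Lemma pseudoinverse_proj : Y *m P = 0.
Proof. by rewrite mulmxBr mulmx1 mulmxA YX mul1mx subrr. Qed.

Lemma ctrmx_proj : ctrmx P = P.
Proof.
have [_ _ XYc _] := pseudoinverseP X.
by rewrite -scaleN1r ctrmxD ctrmxZ XYc rmorphN1 /ctrmx trmx1 map_mx1.
Qed.

Lemma starmxC_X : starmx s C *m X = d *: (starmx s X *m C).
Proof. by rewrite -XC starmxM starmxK. Qed.

Lemma symmetric_solution_mul : symmetric_solution *m X = C.
Proof.
by rewrite mulmxDl -scalemxAl -!mulmxA projX !mulmx0 scaler0 addr0 YX mulmx1.
Qed.

Lemma symmetric_solution_sym :
  starmx s symmetric_solution = d *: symmetric_solution.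
Proof.
(* Once [P] is expanded, the first two terms are C Y and d (C Y)^star, which [starmx] exchanges up
   to [d]; the last inherits its symmetry from X^star C. *)
have -> : symmetric_solution = C *m Y + d *: (starmx s Y *m starmx s C)
    - starmx s Y *m starmx s X *m C *m Y.
  rewrite /symmetric_solution mulmxBr mulmx1 scalerBr addrA; congr (_ - _).
  rewrite !mulmxA -(mulmxA (starmx s Y) (starmx s C)) starmxC_X -scalemxAr -scalemxAl.
  by rewrite scalerA dd scale1r !mulmxA.
rewrite starmxB starmxD starmxZ // !scalerBr scalerDr scalerA dd scale1r.
rewrite !starmxM !starmxK [X in X - _]addrC; congr (_ - _).
by rewrite (mulmxA (starmx s C)) starmxC_X -!scalemxAl -!scalemxAr !mulmxA.
Qed.

Lemma symmetric_solutionP (W : 'M[K]_n) :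
  starmx s W = d *: W /\ W *m X = C <->
  exists Z, starmx s Z = d *: Z
            /\ W = symmetric_solution + starmx s P *m Z *m P.
Proof.
split=> [[Wsym WX] | [Z [Zsym ->]]]; last first.
  split; last by rewrite mulmxDl symmetric_solution_mul -!mulmxA projX !mulmx0 addr0.
  rewrite starmxD symmetric_solution_sym [RHS]scalerDr; congr (_ + _).
  by rewrite !starmxM starmxK Zsym -scalemxAl -scalemxAr mulmxA.
pose D := W - symmetric_solution.
have Dsym : starmx s D = d *: D.
  by rewrite starmxB Wsym symmetric_solution_sym scalerBr.
have DX : D *m X = 0 by rewrite mulmxBl WX symmetric_solution_mul subrr.
have DP : D *m P = D by rewrite mulmxBr mulmx1 mulmxA DX mul0mx subr0.
(* The difference is its own parameter: D P = D because D X = 0, and P^star D = D follows by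
   applying [starmx]. *)
exists D; split=> //.
have -> : starmx s P *m D = D.
  rewrite -[LHS](starmxK s) starmxM starmxK Dsym -scalemxAl DP -Dsym.
  exact: starmxK.
by rewrite DP addrC subrK.
Qed.

(** Both terms vanish by Y P = 0: its starred form kills the second, and a cyclic shift of the trace
    brings [Y] next to [P] in the first. *)
Lemma symmetric_solution_orthogonal (Z : 'M[K]_n) :
  \tr (ctrmx (starmx s P *m Z *m P) *m symmetric_solution) = 0.
Proof.
have PY0 : starmx s P *m starmx s Y = 0.
  by rewrite -starmxM pseudoinverse_proj starmx0.
rewrite !ctrmxM ctrmx_starmx ctrmx_proj mulmxDr linearD /= -scalemxAr.
rewrite !mulmxA -(mulmxA _ _ (starmx s Y)) PY0 mulmx0 !mul0mx scaler0 mxtrace0.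
rewrite addr0 mxtrace_mulC !mulmxA pseudoinverse_proj !mul0mx.
by rewrite mxtrace0.
Qed.

End SymmetricSolutions.

Arguments symmetric_solution {R k} s {n p} d X C.

(** * Translation of structure, residual and norm under left multiplication by [H] *)

Section Structured.

Context {R : realType} {k : scalar_kind} (s : star_kind) (S : algebra_kind).
Context {n : nat}.
Local Notation K := (scalars R k).
Local Notation e2 := (eps2 R k S).

Lemma eps2_sign : e2 = 1 \/ e2 = -1.
Proof. by case: S; [right | left]. Qed.

Lemma cj_sign {a : K} : a = 1 \/ a = -1 -> cj R k a = a.
Proof. by case=> ->; rewrite ?rmorph1 ?rmorphN1. Qed.

Lemma sqr_sign {a : K} : a = 1 \/ a = -1 -> a * a = 1.
Proof. by case=> ->; rewrite ?mulrNN mulr1. Qed.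

Lemma mul_sign {a b : K} :
  a = 1 \/ a = -1 -> b = 1 \/ b = -1 -> a * b = 1 \/ a * b = -1.
Proof.
by case=> ->; case=> ->; rewrite ?mulrNN ?mulr1 ?mul1r; [left|right|right|left].
Qed.

Context {eps1 : K} {H : 'M[K]_n}.
Hypotheses (eps1_sign : eps1 = 1 \/ eps1 = -1) (uH : unitary H).
Hypothesis H_star : starmx s H = eps1 *: H.
Local Notation d := (eps1 * e2).

Lemma unitary_unitmx : H \in unitmx.
Proof. by have [] := mulmx1_unit uH. Qed.

(** Structure means A^star H = e2 H A, while (H A)^star = eps1 A^star H. *)
Lemma structured_mulH (A : 'M[K]_n) :
  structured s S H A <-> starmx s (H *m A) = d *: (H *m A).
Proof.
rewrite structuredE /adjoint starmxM H_star -scalemxAr -scalerA.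
have e11 := sqr_sign eps1_sign.
split=> [HA | /(congr1 ( *:%R eps1))]; last first.
  rewrite !scalerA e11 mul1r scale1r => HA.
  by rewrite -mulmxA HA -scalemxAr mulKmx ?unitary_unitmx.
by rewrite [e2 *: _]scalemxAr -HA -mulmxA mulKVmx ?unitary_unitmx.
Qed.

(** Unitarity cancels [H] from the inner product of H N and H M. *)
Lemma frobenius_mulH_orthogonal (M N : 'M[K]_n) :
  \tr (ctrmx (H *m N) *m (H *m M)) = 0 -> frobenius M <= frobenius (M + N).
Proof.
move=> NM0; apply: frobenius_le_add_orthogonal.
by rewrite -[M]mul1mx -uH !mulmxA -ctrmxM -mulmxA.
Qed.

Context {p : nat} {A : 'M[K]_n} {X : 'M[K]_(n, p)} {L : 'M[K]_p}.
Local Notation Y := (pseudoinverse X).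
Local Notation P := (1%:M - X *m Y).

(** With B = X L - A X, the bracket of [perturbation] is Y^star (H B)^star P with [P] expanded. *)
Lemma mulH_perturbation (Z : 'M[K]_n) :
  H *m perturbation s S eps1 H A X L Z
  = symmetric_solution s d X (H *m (X *m L - A *m X)) + starmx s P *m Z *m P.
Proof.
have XB : starmx s X *m H *m X *m L - starmx s X *m H *m A *m X
    = starmx s X *m (H *m (X *m L - A *m X)).
  by rewrite !mulmxBr !mulmxA.
rewrite /perturbation XB /symmetric_solution; move: (X *m L - A *m X) => B.
rewrite !(mulmxDr H) -scalemxAr !mulmxA mulmxV ?unitary_unitmx // !mul1mx.
congr (_ + _ *: _ + _); rewrite [RHS]mulmxBr mulmx1 (starmxM _ (H *m B)).
by congr (_ - _); rewrite -(mulmxA _ H) starmxM starmxK !mulmxA.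
Qed.

Lemma mulH_residual (dA : 'M[K]_n) :
  (A + dA) *m X = X *m L <-> H *m dA *m X = H *m (X *m L - A *m X).
Proof.
rewrite mulmxDl -mulmxA; split=> [<- | ]; first by rewrite addrC addKr.
move=> /(congr1 (mulmx (invmx H))); rewrite !mulKmx ?unitary_unitmx // => ->.
by rewrite addrC subrK.
Qed.

(** The Gram matrix G = X^star H X inherits the sign [eps1] of [H], so (G L)^star = eps1 L^star
    G. *)
Lemma gram_symmetricP :
  starmx s X *m H *m X *m L = e2 *: (starmx s L *m starmx s X *m H *m X) <->
  starmx s (starmx s X *m H *m X *m L) = d *: (starmx s X *m H *m X *m L).
Proof.
have e11 := sqr_sign eps1_sign; have e22 := sqr_sign eps2_sign.
rewrite !starmxM starmxK H_star -scalemxAl -!scalemxAr -scalerA !mulmxA.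
split=> [-> | /(congr1 ( *:%R (eps1 * e2)))]; first by rewrite !scalerA -mulrA e22 mulr1.
by rewrite !scalerA mulrAC e11 mul1r e22 scale1r => <-.
Qed.

(** X^star C is the difference of X^star H X L and X^star (H A) X; the second is a congruence of the
    d-symmetric H A. *)
Lemma residual_symmetric :
  structured s S H A ->
  starmx s X *m H *m X *m L = e2 *: (starmx s L *m starmx s X *m H *m X) ->
  let C := H *m (X *m L - A *m X) in
  starmx s (starmx s X *m C) = d *: (starmx s X *m C).
Proof.
move=> /structured_mulH HA /gram_symmetricP XL /=.
rewrite !mulmxBr starmxB !mulmxA XL -!mulmxA (mulmxA H A) scalerBr; congr (_ - _).
by rewrite starmxM (starmxM _ (H *m A)) starmxK HA -scalemxAr -scalemxAl !mulmxA.
Qed.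

End Structured.

Theorem proposition2p5 (R : realType) (k : scalar_kind) (s : star_kind)
    (S : algebra_kind) (n p : nat) (eps1 : scalars R k)
    (H A : 'M[scalars R k]_n) (U : {vspace 'cV[scalars R k]_n})
    (X : 'M[scalars R k]_(n, p))
    (eps1_sign : eps1 = 1 \/ eps1 = -1)
    (H_unitary : unitary H)
    (H_star : starmx s H = eps1 *: H)
    (A_in_S : structured s S H A)
    (dim_U : \dim U = p)
    (rank_X : \rank X = p)
    (range_X : colspace X = U) :
  ((exists dA : 'M[scalars R k]_n,
       structured s S H dA /\ invariant_subspace (A + dA) U)
   <->
   (exists L : 'M[scalars R k]_p,
       starmx s X *m H *m X *m L
       = eps2 R k S *: (starmx s L *m starmx s X *m H *m X)))
  /\
  (forall L : 'M[scalars R k]_p,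
     starmx s X *m H *m X *m L
     = eps2 R k S *: (starmx s L *m starmx s X *m H *m X) ->
     (forall dA : 'M[scalars R k]_n,
        (structured s S H dA /\ (A + dA) *m X = X *m L)
        <->
        (exists Z : 'M[scalars R k]_n,
           starmx s Z = (eps1 * eps2 R k S) *: Z
           /\ dA = perturbation s S eps1 H A X L Z))
     /\
     (let dAo := perturbation s S eps1 H A X L 0 in
      [/\ structured s S H dAo, (A + dAo) *m X = X *m L
        & forall dA : 'M[scalars R k]_n,
            structured s S H dA -> (A + dA) *m X = X *m L ->
            frobenius dAo <= frobenius dA])).
Proof.
set e2 := eps2 R k S; have e2_sign := eps2_sign S : e2 = 1 \/ e2 = -1.
have d_sign := mul_sign eps1_sign e2_sign.
have dR := cj_sign d_sign; have dd := sqr_sign d_sign.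
have structP := structured_mulH s S eps1_sign H_unitary H_star.
have solP L (eqL : starmx s X *m H *m X *m L
    = e2 *: (starmx s L *m starmx s X *m H *m X)) (dA : 'M_n) :
    structured s S H dA /\ (A + dA) *m X = X *m L <->
    exists Z, starmx s Z = (eps1 * e2) *: Z
              /\ dA = perturbation s S eps1 H A X L Z.
  have CS := residual_symmetric _ _ eps1_sign H_unitary H_star A_in_S eqL.
  have WP := symmetric_solutionP _ dR dd rank_X CS (H *m dA).
  rewrite structP (mulH_residual H_unitary) WP.
  split=> [] [Z [Zsym eqZ]]; exists Z; split=> //.
    apply: (can_inj (mulKmx (unitary_unitmx H_unitary))).
    by rewrite eqZ mulH_perturbation.
  by rewrite eqZ mulH_perturbation.
have sol0 L (eqL : starmx s X *m H *m X *m L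
    = e2 *: (starmx s L *m starmx s X *m H *m X)) :
    let dAo := perturbation s S eps1 H A X L 0 in
    structured s S H dAo /\ (A + dAo) *m X = X *m L.
  by apply/(solP L eqL); exists 0; rewrite starmx0 scaler0.
split.
  split=> [[dA [dA_S]] | [L eqL]]; last first.
    have [dA_S dA_X] := sol0 L eqL.
    exists (perturbation s S eps1 H A X L 0); split=> //.
    by rewrite -range_X; apply/invariant_colspaceP; exists L.
  rewrite -range_X => /invariant_colspaceP[L XL]; exists L.
  (* Necessity: X^star H X L equals X^star H (A + dA) X, again a congruence of a d-symmetric
     matrix. *)
  have HA : starmx s (H *m (A + dA)) = (eps1 * e2) *: (H *m (A + dA)).
    move/structP: A_in_S => HA; move/structP: dA_S => HdA.
    by rewrite mulmxDr starmxD HA HdA scalerDr.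
  apply/(gram_symmetricP _ _ eps1_sign H_star).
  rewrite -!mulmxA -XL (mulmxA H) starmxM (starmxM _ (H *m _)) starmxK HA.
  by rewrite -scalemxAr -scalemxAl mulmxA.
move=> L eqL; split; first exact: solP.
have [dAo_S dAo_X] := sol0 L eqL; split=> // dA dA_S dA_X.
have /(solP L eqL)[Z [_ ->]] := conj dA_S dA_X.
have -> : perturbation s S eps1 H A X L Z = perturbation s S eps1 H A X L 0
    + invmx H *m starmx s (1%:M - X *m pseudoinverse X) *m Z
      *m (1%:M - X *m pseudoinverse X).
  by rewrite /perturbation !(mulmx0, mul0mx) addr0.
(* After multiplication by [H], the two summands are [symmetric_solution] and P^star Z P. *)
apply: (frobenius_mulH_orthogonal H_unitary).
rewrite mulH_perturbation // !(mulmx0, mul0mx) addr0 !mulmxA.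
rewrite mulmxV ?unitary_unitmx // mul1mx.
exact: symmetric_solution_orthogonal.
Qed.
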